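(* Let $A \in \mathbb{H}^{m\times n}$ have rank $\nu$, let $S, T \in \mathbb{H}^{n\times m}$, and let $X = S (TAS)^{(1)} T$, where $(TAS)^{(1)}$ is a fixed but arbitrary $\{1\}$-inverse of $TAS$. Then: (a) $X$ is the unique matrix $A^{(2)}_{(S,T),(T,S)}$, i.e. the unique matrix in $\mathbb{H}^{n\times m}$ satisfying $XAX=X$, $\mathcal{R}_r(X)=\mathcal{R}_r(S)$, $\mathcal{N}_r(X)=\mathcal{N}_r(T)$, $\mathcal{R}_l(X)=\mathcal{R}_l(T)$ and $\mathcal{N}_l(X)=\mathcal{N}_l(S)$, if and only if $\operatorname{rank}(TAS)=\operatorname{rank}(S)=\operatorname{rank}(T)$. (b) $X$ is the unique matrix $A^{(1,2)}_{(S,T),(T,S)}$, i.e. the unique matrix in $\mathbb{H}^{n\times m}$ satisfying $AXA=A$ together with all the conditions $XAX=X$, $\mathcal{R}_r(X)=\mathcal{R}_r(S)$, $\mathcal{N}_r(X)=\mathcal{N}_r(T)$, $\mathcal{R}_l(X)=\mathcal{R}_l(T)$ and $\mathcal{N}_l(X)=\mathcal{N}_l(S)$, if and only if $\operatorname{rank}(TAS)=\operatorname{rank}(S)=\operatorname{rank}(T)=\nu$.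
   Context: $\mathbb{H}$ denotes the real quaternions and $\mathbb{H}^{m\times n}$ the set of $m\times n$ quaternion matrices. For $B\in\mathbb{H}^{m\times n}$: $\mathcal{R}_r(B)=\{Bx : x\in\mathbb{H}^{n\times 1}\}$, $\mathcal{N}_r(B)=\{x\in\mathbb{H}^{n\times 1} : Bx=0\}$ (right range and null space), and $\mathcal{R}_l(B)=\{xB : x\in\mathbb{H}^{1\times m}\}$, $\mathcal{N}_l(B)=\{x\in\mathbb{H}^{1\times m} : xB=0\}$ (left range and null space). The rank of $B$ is the maximal number of right linearly independent columns of $B$ (equivalently, the maximal number of left linearly independent rows). A $\{1\}$-inverse of $B\in\mathbb{H}^{m\times n}$ is any $Y\in\mathbb{H}^{n\times m}$ with $BYB=B$. *)

(* Defs.v *)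
From HB Require Import structures.
From mathcomp Require Import all_boot all_order all_algebra.
From mathcomp Require Import ring.
From mathcomp Require Import boolp classical_sets reals.

Set Implicit Arguments.
Unset Strict Implicit.
Unset Printing Implicit Defensive.

Import GRing.Theory.

Local Open Scope classical_set_scope.
Local Open Scope ring_scope.

(* Quat a b c d stands for a + b i + c j + d k. *)
Record quaternion (R : Type) : Type :=
  Quat { quat_re : R; quat_i : R; quat_j : R; quat_k : R }.

Definition tuple_of_quat (R : Type) (q : quaternion R) : R * R * R * R :=
  (quat_re q, quat_i q, quat_j q, quat_k q).

Definition quat_of_tuple (R : Type) (t : R * R * R * R) : quaternion R :=
  Quat t.1.1.1 t.1.1.2 t.1.2 t.2.

Lemma tuple_of_quatK (R : Type) :
  cancel (@tuple_of_quat R) (@quat_of_tuple R).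
Proof. by case. Qed.

HB.instance Definition _ (R : choiceType) :=
  Choice.copy (quaternion R) (can_type (@tuple_of_quatK R)).

Section QuaternionRing.
Variable R : comNzRingType.
Implicit Types p q r : quaternion R.

Definition quat_zero : quaternion R := Quat 0 0 0 0.

Definition quat_one : quaternion R := Quat 1 0 0 0.

Definition quat_opp q : quaternion R :=
  Quat (- quat_re q) (- quat_i q) (- quat_j q) (- quat_k q).

Definition quat_add p q : quaternion R :=
  Quat (quat_re p + quat_re q) (quat_i p + quat_i q)
       (quat_j p + quat_j q) (quat_k p + quat_k q).

(* Hamilton's product: i^2 = j^2 = k^2 = ijk = -1. *)
Definition quat_mul p q : quaternion R :=
  let: Quat a1 b1 c1 d1 := p in
  let: Quat a2 b2 c2 d2 := q in
  Quat (a1 * a2 - b1 * b2 - c1 * c2 - d1 * d2)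
       (a1 * b2 + b1 * a2 + c1 * d2 - d1 * c2)
       (a1 * c2 - b1 * d2 + c1 * a2 + d1 * b2)
       (a1 * d2 + b1 * c2 - c1 * b2 + d1 * a2).

Lemma quat_addA : associative quat_add.
Proof.
by move=> [a b c d] [a' b' c' d'] [a'' b'' c'' d'']; rewrite /quat_add /= !addrA.
Qed.

Lemma quat_addC : commutative quat_add.
Proof. by move=> [a b c d] [a' b' c' d']; congr Quat; exact: addrC. Qed.

Lemma quat_add0 : left_id quat_zero quat_add.
Proof. by move=> [a b c d]; rewrite /quat_add /= !add0r. Qed.

Lemma quat_addN : left_inverse quat_zero quat_opp quat_add.
Proof. by move=> [a b c d]; rewrite /quat_add /= !addNr. Qed.

HB.instance Definition _ :=
  GRing.isZmodule.Build (quaternion R) quat_addA quat_addC quat_add0 quat_addN.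

Lemma quat_mulA : associative quat_mul.
Proof. by move=> [? ? ? ?] [? ? ? ?] [? ? ? ?]; congr Quat; ring. Qed.

Lemma quat_mul1l : left_id quat_one quat_mul.
Proof. by move=> [? ? ? ?]; congr Quat; ring. Qed.

Lemma quat_mul1r : right_id quat_one quat_mul.
Proof. by move=> [? ? ? ?]; congr Quat; ring. Qed.

Lemma quat_mulDl : left_distributive quat_mul quat_add.
Proof. by move=> [? ? ? ?] [? ? ? ?] [? ? ? ?]; congr Quat => /=; ring. Qed.

Lemma quat_mulDr : right_distributive quat_mul quat_add.
Proof. by move=> [? ? ? ?] [? ? ? ?] [? ? ? ?]; congr Quat => /=; ring. Qed.

Lemma quat_one_neq0 : quat_one != quat_zero.
Proof. by apply/eqP => -[] /eqP; rewrite oner_eq0. Qed.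

HB.instance Definition _ :=
  GRing.Zmodule_isNzRing.Build (quaternion R)
    quat_mulA quat_mul1l quat_mul1r quat_mulDl quat_mulDr quat_one_neq0.

End QuaternionRing.

Section QuaternionMatrix.
Variables (R : realType) (m n : nat).
Local Notation H := (quaternion R).
Implicit Types B : 'M[H]_(m, n).

Definition right_range B : set 'cV[H]_m := [set B *m x | x in [set: 'cV[H]_n]].

Definition right_null B : set 'cV[H]_n := [set x | B *m x = 0].

Definition left_range B : set 'rV[H]_n := [set x *m B | x in [set: 'rV[H]_m]].

Definition left_null B : set 'rV[H]_m := [set x | x *m B = 0].

(* The scalars multiply on the right, whereas MathComp's [*:] acts on the left. *)
Definition right_independent_cols B (J : {set 'I_n}) : Prop :=
  forall c : 'I_n -> H,
    (forall i, \sum_(j in J) B i j * c j = 0) -> forall j, j \in J -> c j = 0.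

(* MathComp's [\rank] requires a commutative field of scalars. *)
Definition quat_rank B : nat :=
  (\max_(J : {set 'I_n} | `[< right_independent_cols B J >]) #|J|)%N.

End QuaternionMatrix.

Section GeneralizedInverse.
Variables (R : realType) (m n : nat).
Local Notation H := (quaternion R).
Implicit Types (B : 'M[H]_(m, n)) (S T X Y : 'M[H]_(n, m)).

Definition is_1inverse B Y : Prop := B *m Y *m B = B.

(* The outer inverse of B with right range and left null space prescribed by S,
   and right null space and left range prescribed by T. *)
Definition is_2inverse_ST B S T X : Prop :=
  [/\ X *m B *m X = X,
      right_range X = right_range S,
      right_null X = right_null T,
      left_range X = left_range T &
      left_null X = left_null S].

Definition is_12inverse_ST B S T X : Prop :=
  is_1inverse B X /\ is_2inverse_ST B S T X.

End GeneralizedInverse.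

(* Main.v *)
(** The conditions on the ranks say exactly that [S = X A S] and [T = T A X].
    Indeed multiplying a matrix on the left without lowering its rank keeps its
    right null space, and multiplying it on the right without lowering its rank
    keeps its right range; for [T A S] these two facts, combined with the
    {1}-inverse [G], give the two identities.  They imply that [X] is an outer
    inverse with the prescribed ranges and null spaces, and that any other such
    matrix [Y] satisfies [X = X A Y = Y]. *)
Require Import Defs.
From mathcomp Require Import all_boot all_order all_algebra.
From mathcomp Require Import ring.
From mathcomp Require Import boolp classical_sets reals.

Import Order.TTheory GRing.Theory Num.Theory.

Local Open Scope ring_scope.

(** * Right independence and rank over the quaternions *)

Section Rank.
Set Implicit Arguments.
Unset Strict Implicit.
Variable R : realType.
Local Notation H := (quaternion R).

(** The inverse is the conjugate divided by the squared norm [N], a sum of squares that vanishes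
    only at zero. *)
Lemma quat_inverse (q : H) :
  q != 0 -> exists p, p * q = 1 /\ q * p = 1.
Proof.
case: q => a b c d q0; pose N := a ^+ 2 + b ^+ 2 + c ^+ 2 + d ^+ 2.
have N0 : N != 0.
  apply: contra q0; rewrite /N !paddr_eq0 ?addr_ge0 ?sqr_ge0 // !sqrf_eq0.
  by case/andP => /andP[/andP[/eqP-> /eqP->] /eqP->] /eqP->.
exists (Quat (a / N) (- b / N) (- c / N) (- d / N)).
by split; congr Quat => /=; rewrite /N; field; exact: N0.
Qed.

(** This is right linear independence of all the columns of [P], free of index sets. *)
Definition injective_mx m k (P : 'M[H]_(m, k)) : Prop :=
  forall x : 'cV[H]_k, P *m x = 0 -> x = 0.

Lemma injective_mx_mul_r m p k (P : 'M[H]_(m, p)) (Q : 'M[H]_(p, k)) :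
  injective_mx (P *m Q) -> injective_mx Q.
Proof. by move=> PQ x Qx; apply: PQ; rewrite -mulmxA Qx mulmx0. Qed.

Lemma mulmx_ext m k p (B : 'M[H]_(m, k)) (C : 'M[H]_(p, k)) :
  (forall x : 'cV[H]_k, B *m x = 0 -> C *m x = 0) ->
  forall q (x : 'M[H]_(k, q)), B *m x = 0 -> C *m x = 0.
Proof.
move=> BC q x Bx; apply/matrixP => i j.
have /BC/matrixP/(_ i 0) : B *m col j x = 0 by rewrite colE mulmxA Bx mul0mx.
by rewrite colE mulmxA -colE !mxE.
Qed.

(* Elimination of one equation: [E] parametrises the solutions of the first
   equation, one of whose coefficients is invertible. *)
Lemma injective_mx_leq r k (M : 'M[H]_(r, k)) : injective_mx M -> (k <= r)%N.
Proof.
elim: r k M => [|r IHr] [|k] // M Minj.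
  have /Minj/matrixP/(_ 0 0) : M *m const_mx 1 = 0 :> 'cV_0.
    by apply/matrixP => -[].
  by rewrite !mxE => /eqP; rewrite oner_eq0.
pose M' := dsubmx (M : 'M_(1 + r, k.+1)).
have usub0 q (x : 'M[H]_(k.+1, q)) :
    usubmx (M : 'M_(1 + r, k.+1)) *m x = 0 -> M' *m x = 0 -> M *m x = 0.
  move=> Ux Dx; have := mul_col_mx (usubmx (M : 'M_(1 + r, k.+1))) M' x.
  by rewrite vsubmxK Ux Dx col_mx0.
have [j Mj|M0] := pickP (fun j => M 0 j != 0); last first.
  apply: ltnW; apply: (IHr _ M') => x Mx; apply/Minj/usub0 => //.
  rewrite (_ : usubmx _ = 0) ?mul0mx //; apply/matrixP => i j.
  rewrite !mxE ord1 (_ : lshift r 0 = 0); last exact/val_inj.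
  by have /negbFE/eqP := M0 j.
have [p [pM Mp]] := quat_inverse Mj.
pose E : 'M[H]_(k.+1, k) := \matrix_(i, l)
  if unlift j i is Some i' then (i' == l)%:R else - (p * M 0 (lift j l)).
have Elift (y : 'cV[H]_k) i' : (E *m y) (lift j i') 0 = y i' 0.
  rewrite mxE (bigD1 i') //= big1 ?addr0; last first.
    by move=> l li; rewrite mxE liftK eq_sym (negPf li) mul0r.
  by rewrite mxE liftK eqxx mul1r.
have UE : usubmx (M : 'M_(1 + r, k.+1)) *m E = 0.
  apply/matrixP => i l; rewrite !mxE ord1.
  rewrite (bigD1_ord j) //= !mxE unlift_none.
  rewrite (_ : lshift r 0 = 0); last exact/val_inj.
  rewrite mulrN mulrA Mp mul1r (bigD1 l) //= big1.
    rewrite !mxE liftK eqxx mulr1 addr0.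
    rewrite (_ : lshift r 0 = 0); last exact/val_inj.
    by rewrite addNr.
  by move=> i' il; rewrite !mxE liftK (negPf il) mulr0.
apply: (IHr _ (M' *m E)) => y My.
have Ey : E *m y = 0.
  by apply/Minj/usub0; rewrite mulmxA ?UE ?mul0mx.
by apply/matrixP => i l; rewrite ord1 -Elift Ey !mxE.
Qed.

(** A nontrivial relation must give [b] a nonzero coefficient; dividing by it on the right solves
    for [b]. *)
Lemma row_mx_not_injective m k (P : 'M[H]_(m, k)) (b : 'cV[H]_m) :
  injective_mx P -> ~ injective_mx (row_mx P b) -> exists x, b = P *m x.
Proof.
move=> Pinj ninj; apply: contrapT => nspan; apply: ninj => x.
rewrite -[x]vsubmxK mul_row_col; move: (usubmx x) (dsubmx x) => u t Put.
have [t0|t0] := eqVneq (t 0 0) 0.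
  move: Put; rewrite [t]mx11_scalar t0 raddf0 mulmx0 addr0 => /Pinj ->.
  by rewrite col_mx0.
have [p [_ tp]] := quat_inverse t0.
case: nspan; exists (- (u *m p%:M)).
have /(congr1 (mulmx^~ p%:M)) := Put.
rewrite mulmxDl mul0mx -!mulmxA [t]mx11_scalar -scalar_mxM tp mulmx1.
by move/eqP; rewrite addrC addr_eq0 => /eqP ->; rewrite mulmxN.
Qed.

Lemma col_span m n k (B : 'M[H]_(m, n)) (P : 'M[H]_(m, k)) :
  (forall j, exists x, col j B = P *m x) -> exists W, B = P *m W.
Proof.
move=> /choice[f fP]; exists (\matrix_(i, j) f j i 0).
apply/matrixP => i j; have /matrixP/(_ i 0) := fP j.
by rewrite !mxE => ->; apply: eq_bigr => l _; rewrite mxE.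
Qed.

Lemma colsub_mulmx m n (B : 'M[H]_(m, n)) (J : {set 'I_n}) (c : 'I_n -> H) i :
  (colsub (enum_val : 'I_#|J| -> _) B *m \col_l c (enum_val l)) i 0 =
  \sum_(j in J) B i j * c j.
Proof.
by rewrite mxE [RHS]big_enum_val; apply: eq_bigr => l _; rewrite !mxE.
Qed.

Lemma right_independent_colsP m n (B : 'M[H]_(m, n)) (J : {set 'I_n}) :
  right_independent_cols B J <->
  injective_mx (colsub (enum_val : 'I_#|J| -> _) B).
Proof.
split=> [Jind x Bx|Jinj c Bc j jJ].
  apply/matrixP => l l'; rewrite ord1 mxE.
  (* The vector [x], indexed by positions in [J], is extended by zero to all column indices. *)
  pose c j := if [pick l | enum_val l == j :> 'I_n] is Some l then x l 0 else 0.
  have cE (l0 : 'I_#|J|) : c (enum_val l0) = x l0 0.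
    rewrite /c; case: pickP => [l1 /eqP/enum_val_inj -> //|/(_ l0)].
    by rewrite eqxx.
  rewrite -cE; apply: Jind (enum_valP l) => i; rewrite -colsub_mulmx.
  rewrite (_ : \col_l0 _ = x) ?Bx ?mxE //.
  by apply/matrixP => l0 l1; rewrite mxE ord1 cE.
have /matrixP/(_ (enum_rank_in jJ j) 0) : \col_l c (enum_val (l : 'I_#|J|)) = 0.
  by apply: Jinj; apply/matrixP => i l; rewrite ord1 colsub_mulmx Bc mxE.
by rewrite !mxE enum_rankK_in.
Qed.

(** Rank factorization: [P] consists of the columns of [B] in an independent set of largest size,
    and by maximality they span the others. *)
Lemma quat_rank_factor m n (B : 'M[H]_(m, n)) :
  exists (P : 'M[H]_(m, quat_rank B)) V W,
    [/\ injective_mx P, P = B *m V & B = P *m W].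
Proof.
have [J Jind rankB] : exists2 J, right_independent_cols B J & quat_rank B = #|J|.
  pose ind := [pred J : {set 'I_n} | `[< right_independent_cols B J >]].
  have ind0 : (0 < #|ind|)%N.
    by apply/card_gt0P; exists finset.set0; apply/asboolP => c _ j; rewrite inE.
  have [J Jind rankB] := eq_bigmax_cond (fun J : {set 'I_n} => #|J|) ind0.
  by exists J => //; apply/asboolP.
rewrite rankB; set P := colsub (enum_val : 'I_#|J| -> _) B.
have Pinj : injective_mx P by apply/right_independent_colsP.
have [W BW] : exists W, B = P *m W.
  apply: col_span => j; have [jJ|jJ] := boolP (j \in J).
    exists (delta_mx (enum_rank_in jJ j) 0).
    by rewrite -colE; apply/matrixP => i l; rewrite !mxE enum_rankK_in.
  apply: row_mx_not_injective => // Pj.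
  (* Were column [j] independent of [P], adding it to [J] would exceed the maximum. *)
  have : right_independent_cols B (j |: J).
    move=> c Bc; pose x := \col_l c (enum_val (l : 'I_#|J|)).
    have /Pj : row_mx P (col j B) *m col_mx x (c j)%:M = 0.
      apply/matrixP => i l; rewrite ord1 mul_row_col mxE colsub_mulmx.
      rewrite [X in _ + X]mxE big_ord1 !mxE eqxx mulr1n addrC.
      by have := Bc i; rewrite big_setU1.
    rewrite -col_mx0 => /eq_col_mx[x0 /matrixP/(_ 0 0)].
    rewrite !mxE eqxx mulr1n => cj i; rewrite inE => /orP[/set1P ->//|iJ].
    have /matrixP/(_ (enum_rank_in iJ i) 0) := x0.
    by rewrite !mxE enum_rankK_in.
  move=> ind; have := @leq_bigmax_cond _
    (fun K => `[< right_independent_cols B K >]) (fun K => #|K|) _ (asboolT ind).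
  by rewrite -/(quat_rank B) rankB cardsU1 jJ ltnn.
exists P, (colsub enum_val 1%:M), W; split => //.
by rewrite /P mulmx_colsub mulmx1.
Qed.

(** The rank also bounds independent combinations of columns: with [B = P *m W], the matrix [W *m V]
    is injective and has [quat_rank B] rows. *)
Lemma injective_mx_leq_rank m n k (B : 'M[H]_(m, n)) (V : 'M[H]_(n, k)) :
  injective_mx (B *m V) -> (k <= quat_rank B)%N.
Proof.
have [P [_ [W [_ _ {1}->]]]] := quat_rank_factor B.
by rewrite -mulmxA => /injective_mx_mul_r/injective_mx_leq.
Qed.

Lemma injective_mx_rank_span m n (B : 'M[H]_(m, n)) (V : 'M[H]_(n, quat_rank B)) :
  injective_mx (B *m V) -> exists W, B = B *m V *m W.
Proof.
move=> BVinj; apply: col_span => j; apply: row_mx_not_injective => // inj.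
have : (quat_rank B + 1 <= quat_rank B)%N.
  apply: (@injective_mx_leq_rank _ _ _ B (row_mx V (delta_mx j 0))).
  by rewrite mul_mx_row -colE.
by rewrite addn1 ltnn.
Qed.

(** * Rank of a product *)

Lemma quat_rank_mul_l m n p (U : 'M[H]_(p, m)) (B : 'M[H]_(m, n)) :
  (quat_rank (U *m B) <= quat_rank B)%N.
Proof.
have [P [V [_ [Pinj PV _]]]] := quat_rank_factor (U *m B).
apply: (@injective_mx_leq_rank _ _ _ _ V); apply: (@injective_mx_mul_r _ _ _ U).
by rewrite mulmxA -PV.
Qed.

Lemma quat_rank_mul_r m n p (B : 'M[H]_(m, n)) (V : 'M[H]_(n, p)) :
  (quat_rank (B *m V) <= quat_rank B)%N.
Proof.
have [P [V' [_ [Pinj PV _]]]] := quat_rank_factor (B *m V).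
by apply: (@injective_mx_leq_rank _ _ _ _ (V *m V')); rewrite mulmxA -PV.
Qed.

(** Some [B *m V] with [quat_rank B] columns stays independent after multiplication by [U]; it spans
    the columns of [B], so [U] is injective on the range of [B]. *)
Lemma quat_rank_mul_l_null m n p (U : 'M[H]_(p, m)) (B : 'M[H]_(m, n)) :
  quat_rank (U *m B) = quat_rank B ->
  forall q (x : 'M[H]_(n, q)), U *m B *m x = 0 -> B *m x = 0.
Proof.
move=> rankUB; apply: mulmx_ext => x UBx.
have [P [V [_ [Pinj PV _]]]] := quat_rank_factor (U *m B).
move: P V Pinj PV; rewrite rankUB => P V Pinj PV.
have UBVinj : injective_mx (U *m (B *m V)) by rewrite mulmxA -PV.
have [W BW] := injective_mx_rank_span (injective_mx_mul_r UBVinj).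
rewrite BW -mulmxA (UBVinj (W *m x)) ?mulmx0 //.
by rewrite -mulmxA (mulmxA (B *m V)) -BW mulmxA.
Qed.

Lemma quat_rank_mul_r_range m n p (B : 'M[H]_(m, n)) (V : 'M[H]_(n, p)) :
  quat_rank (B *m V) = quat_rank B -> exists W, B = B *m V *m W.
Proof.
move=> rankBV.
have [P [V' [_ [Pinj PV _]]]] := quat_rank_factor (B *m V).
move: P V' Pinj PV; rewrite rankBV => P V' Pinj PV.
have [|W BW] := @injective_mx_rank_span _ _ B (V *m V'); first by rewrite mulmxA -PV.
by exists (V' *m W); rewrite {1}BW !mulmxA.
Qed.

End Rank.

(** * Ranges, null spaces and outer inverses *)

Section Ranges.
Set Implicit Arguments.
Unset Strict Implicit.
Variable R : realType.
Local Notation H := (quaternion R).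

Lemma right_range_mul m n p (B : 'M[H]_(m, n)) (C : 'M[H]_(m, p)) :
  (right_range B `<=` right_range C)%classic <-> exists W, B = C *m W.
Proof.
split=> [BC|[W ->] _ [x _ <-]]; last by exists (W *m x); rewrite ?mulmxA.
apply: col_span => j; have [|x _ <-] := BC (col j B); last by exists x.
by exists (delta_mx j 0); rewrite -?colE.
Qed.

Lemma left_range_mul m n p (B : 'M[H]_(m, n)) (C : 'M[H]_(p, n)) :
  (left_range B `<=` left_range C)%classic <-> exists W, B = W *m C.
Proof.
split=> [BC|[W ->] _ [x _ <-]]; last by exists (x *m W); rewrite ?mulmxA.
have /choice[f fP] : forall i, exists x, row i B = x *m C.
  move=> i; have [|x _ <-] := BC (row i B); last by exists x.
  by exists (delta_mx 0 i); rewrite -?rowE.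
exists (\matrix_i f i); apply/row_matrixP => i.
by rewrite row_mul rowK fP.
Qed.

Lemma right_null_mul m n p (U : 'M[H]_(p, m)) (B : 'M[H]_(m, n)) :
  (right_null B `<=` right_null (U *m B))%classic.
Proof. by move=> x Bx; rewrite /right_null /= -mulmxA Bx mulmx0. Qed.

Lemma left_null_mul m n p (B : 'M[H]_(m, n)) (U : 'M[H]_(n, p)) :
  (left_null B `<=` left_null (B *m U))%classic.
Proof. by move=> x Bx; rewrite /left_null /= mulmxA Bx mul0mx. Qed.

Variables (m n : nat) (A : 'M[H]_(m, n)) (S T : 'M[H]_(n, m)).
Implicit Types X Y : 'M[H]_(n, m).

(** By [X *m A *m X = X], left multiplication by [X *m A] fixes the right range of [X], which is
    that of [S]; dually for [T]. *)
Lemma is_2inverse_ST_mul X :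
  is_2inverse_ST A S T X -> X *m A *m S = S /\ T *m A *m X = T.
Proof.
case=> XAX rS _ lT _; split.
  have [|W ->] := (right_range_mul S X).1; first by rewrite rS.
  by rewrite mulmxA XAX.
have [|W ->] := (left_range_mul T X).1; first by rewrite lT.
by rewrite -!mulmxA (mulmxA X) XAX.
Qed.

Lemma is_2inverse_ST_unique X Y :
  is_2inverse_ST A S T X -> is_2inverse_ST A S T Y -> X = Y.
Proof.
move=> HX HY; have [XAS _] := is_2inverse_ST_mul HX.
case: HX HY => XAX rX _ lX _ [YAY rY _ lY _].
have [|W XW] := (left_range_mul X Y).1; first by rewrite lX lY.
have [|Z YZ] := (right_range_mul Y S).1; first by rewrite rY.
(* [Y = S *m Z] gives [Y = X *m A *m Y], and [X = W *m Y] turns the right side into [X]. *)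
rewrite [RHS]YZ -XAS -mulmxA -YZ [in RHS]XW -!mulmxA (mulmxA Y) YAY.
exact: XW.
Qed.

Lemma quat_rank_right_range X : right_range X = right_range S ->
  quat_rank X = quat_rank S.
Proof.
move=> rX; apply/eqP; rewrite eqn_leq.
have [|V XV] := (right_range_mul X S).1; first by rewrite rX.
have [|W SW] := (right_range_mul S X).1; first by rewrite rX.
by rewrite {1}XV quat_rank_mul_r SW quat_rank_mul_r.
Qed.

Lemma quat_rank_is_2inverse_ST (G : 'M[H]_(m, n)) :
  is_2inverse_ST A S T (S *m G *m T) ->
  quat_rank (T *m A *m S) = quat_rank S /\ quat_rank S = quat_rank T.
Proof.
move=> /is_2inverse_ST_mul[XAS TAX].
have rankS : quat_rank (T *m A *m S) = quat_rank S.
  (* [S] is a left multiple of [T *m A *m S], and below [T] is a right multiple of it. *)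
  apply/eqP; rewrite eqn_leq quat_rank_mul_l /= -[X in (quat_rank X <= _)%N]XAS.
  by rewrite -!mulmxA (mulmxA S G) (mulmxA T) quat_rank_mul_l.
split=> //; rewrite -rankS; apply/eqP; rewrite eqn_leq -mulmxA quat_rank_mul_r /=.
by rewrite -[X in (quat_rank X <= _)%N]TAX !mulmxA -(mulmxA _ G) quat_rank_mul_r.
Qed.

Lemma is_2inverse_ST_rank (G : 'M[H]_(m, n)) :
  is_1inverse (T *m A *m S) G ->
  quat_rank (T *m A *m S) = quat_rank S -> quat_rank S = quat_rank T ->
  is_2inverse_ST A S T (S *m G *m T).
Proof.
move=> GE rankS rankST; have rankT := etrans rankS rankST.
have SE : S *m G *m T *m A *m S = S.
  (* [T *m A *m S] kills this second factor because [G] is a {1}-inverse, hence so does [S], which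
     has the same right null space. *)
  have : S *m (1%:M - G *m (T *m A *m S)) = 0.
    apply: (quat_rank_mul_l_null rankS).
    by rewrite mulmxBr mulmx1 (mulmxA _ G) GE subrr.
  by rewrite mulmxBr mulmx1 => /subr0_eq; rewrite !mulmxA => <-.
have TE : T *m A *m S *m G *m T = T.
  (* Equal ranks give [T = T *m A *m S *m W], and the {1}-inverse identity absorbs [G]. *)
  have [|W TW] := @quat_rank_mul_r_range _ _ _ _ T (A *m S).
    by rewrite mulmxA.
  by rewrite mulmxA in TW; rewrite {2 3}TW mulmxA GE.
split.
- by rewrite !mulmxA SE.
- apply/seteqP; split; apply/right_range_mul.
    by exists (G *m T); rewrite mulmxA.
  by exists (A *m S); rewrite !mulmxA SE.
- apply/seteqP; split; last exact: right_null_mul.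
  by rewrite -{2}TE -!mulmxA (mulmxA T) (mulmxA S); exact: right_null_mul.
- apply/seteqP; split; apply/left_range_mul.
    by exists (S *m G).
  by exists (T *m A); rewrite !mulmxA TE.
- apply/seteqP; split; last by rewrite -mulmxA; exact: left_null_mul.
  by rewrite -{2}SE -(mulmxA _ A S); exact: left_null_mul.
Qed.

(** If each matrix is an inner inverse of the other, each rank bounds the other. Conversely, equal
    ranks give [A = A *m X *m W], which [A *m X *m A] reproduces since [X *m A *m X = X]. *)
Lemma is_1inverse_rank X : X *m A *m X = X ->
  is_1inverse A X <-> quat_rank X = quat_rank A.
Proof.
move=> XAX; split=> [AXA|rankX].
  apply/eqP; rewrite eqn_leq -{1}XAX -[X in _ && (quat_rank X <= _)%N]AXA.
  rewrite (leq_trans (quat_rank_mul_r _ _) (quat_rank_mul_l _ _)) /=.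
  exact: leq_trans (quat_rank_mul_r _ _) (quat_rank_mul_l _ _).
have rankAX : quat_rank (A *m X) = quat_rank A.
  apply/eqP; rewrite eqn_leq quat_rank_mul_r -rankX -{1}XAX -mulmxA.
  exact: quat_rank_mul_l.
have [W AW] := quat_rank_mul_r_range rankAX.
by rewrite /is_1inverse {2}AW !mulmxA -(mulmxA A X A) -(mulmxA A) XAX -AW.
Qed.

End Ranges.

Theorem theorem4p5 (R : realType) (m n nu : nat)
    (A : 'M[quaternion R]_(m, n)) (S T : 'M[quaternion R]_(n, m))
    (G : 'M[quaternion R]_(m, n)) (X : 'M[quaternion R]_(n, m))
    (rankA : quat_rank A = nu)
    (G_inv : is_1inverse (T *m A *m S) G)
    (defX : X = S *m G *m T) :
  (unique (is_2inverse_ST A S T) X <->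
     quat_rank (T *m A *m S) = quat_rank S /\ quat_rank S = quat_rank T)
  /\
  (unique (is_12inverse_ST A S T) X <->
     [/\ quat_rank (T *m A *m S) = quat_rank S, quat_rank S = quat_rank T
       & quat_rank T = nu]).
Proof.
(* Uniqueness is automatic, so this equivalence settles the first claim; for the second, [X] has the
   rank of [S], which is compared with that of [A]. *)
have outer_rank : is_2inverse_ST A S T X <->
    quat_rank (T *m A *m S) = quat_rank S /\ quat_rank S = quat_rank T.
  rewrite defX; split; first exact: quat_rank_is_2inverse_ST.
  by case; exact: is_2inverse_ST_rank.
split.
  split=> [[/outer_rank]//|/outer_rank HX].
  by split=> // Y; exact: is_2inverse_ST_unique.
split=> [[[AXA HX] _]|[rankS rankT rankTA]].
  have [rankS rankT] := outer_rank.1 HX; split=> //.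
  case: HX => XAX rX _ _ _.
  by rewrite -rankT -(quat_rank_right_range rX) -rankA; apply/is_1inverse_rank.
have HX := outer_rank.2 (conj rankS rankT).
split; last by move=> Y [_]; exact: is_2inverse_ST_unique.
split=> //; case: HX => XAX rX _ _ _; apply/(is_1inverse_rank XAX).
by rewrite (quat_rank_right_range rX) rankT rankTA.
Qed.
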